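(* The pair $(\{\mathcal{K}_k(x;y)\}_{k=0}^\infty,\{1\}_{k=0}^\infty)$ is a palindromic pair with degree $d(n)=n$.
   Context: Palindromic pairs. Let $\{p_k(x;y)\}_{k=0}^\infty$ be a sequence of polynomials in two variables with $p_0(x;y)=1$, $\{a_k\}_{k=0}^\infty$ a sequence of non-zero numbers, and $d\colon\mathbb{Z}_{\ge0}\to\mathbb{R}$ a map. For $n\in\mathbb{Z}_{\ge0}$ put $\mathscr{S}_k(p;n)=\{s\in\mathbb{C}:p_k(s;n)=0\}$. The pair $(\{p_k\},\{a_k\})$ is a palindromic pair with degree $d(n)$ if, for each $n\in\mathbb{Z}_{\ge 0}$ with $d(n)\in\mathbb{Z}_{\ge0}$, there exists a map $\theta_{(p;n)}\colon\mathscr{S}_{d(n)+1}(p;n)\to\{\pm1\}$ such that for all $s\in\mathscr{S}_{d(n)+1}(p;n)$ we have $p_k(s;n)=0$ for $k\ge d(n)+1$ and $\frac{p_k(s;n)}{a_k}=\theta_{(p;n)}(s)\frac{p_{d(n)-k}(s;n)}{a_{d(n)-k}}$ for $0\le k\le d(n)$. Krawtchouk polynomials: $\mathcal{K}_k(x;y)=\sum_{j=0}^k(-1)^j\binom{x}{j}\binom{y-x}{k-j}$ for $k\in\mathbb{Z}_{\ge0}$, where $\binom{u}{m}=\frac{u(u-1)\cdots(u-m+1)}{m!}$ for $m\ge1$ and $\binom u0=1$. $\{1\}_{k=0}^\infty$ is the constant sequence $a_k=1$. *)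

(* Defs.v *)
From mathcomp Require Import all_boot all_order all_algebra.
From mathcomp Require Import complex.
From mathcomp Require Import classical_sets functions reals.
From mathcomp Require Import mpoly.

Set Implicit Arguments.
Unset Strict Implicit.
Unset Printing Implicit Defensive.

Import GRing.Theory.

Local Open Scope ring_scope.
Local Open Scope classical_set_scope.

(* Value at x = s, y = t of a polynomial p(x; y): the first variable of
   {mpoly C[2]} is x and the second one is y. *)
Definition eval2 (C : comNzRingType) (p : {mpoly C[2]}) (s t : C) : C :=
  p.@[tnth [tuple s; t]].

Definition zeros (C : comNzRingType) (p : nat -> {mpoly C[2]}) (k n : nat) :
    set C :=
  [set s | eval2 (p k) s n%:R = 0].

(* The map theta on zeros p m.+1 n is a total function on R[i] whose values
   outside that set are irrelevant; set_fun A B f says that f maps A to B. *)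
Definition palindromic_pair (R : realType) (p : nat -> {mpoly R[i][2]})
    (a : nat -> R[i]) (d : nat -> R) : Prop :=
  [/\ p 0%N = 1,
      forall k, a k != 0 &
      forall n m : nat, d n = m%:R ->
        exists2 theta : R[i] -> R[i],
          set_fun (zeros p m.+1 n) [set 1; -1] theta &
          forall s, zeros p m.+1 n s ->
            (forall k, (m.+1 <= k)%N -> eval2 (p k) s n%:R = 0) /\
            (forall k, (k <= m)%N ->
               eval2 (p k) s n%:R / a k =
               theta s * (eval2 (p (m - k)%N) s n%:R / a (m - k)%N))].

Definition gbinom (F : fieldType) (u : {mpoly F[2]}) (m : nat) : {mpoly F[2]} :=
  (m`!%:R^-1 : F) *: \prod_(i < m) (u - i%:R).

Definition krawtchouk (F : fieldType) (k : nat) : {mpoly F[2]} :=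
  let x : {mpoly F[2]} := 'X_0 in
  let y : {mpoly F[2]} := 'X_1 in
  \sum_(j < k.+1) (-1) ^+ j * gbinom x j * gbinom (y - x) (k - j).

(* Main.v *)
Require Import Defs.
From mathcomp Require Import all_boot all_order all_algebra.
From mathcomp Require Import complex.
From mathcomp Require Import classical_sets functions reals.
From mathcomp Require Import mpoly.

(** For natural numbers i <= n, Vandermonde's convolution says that K_k(i; n) is
    the coefficient of X^k in (1 - X)^i (1 + X)^(n - i)
    ([krawtchoukr_coef]).  This polynomial has degree n, so these values vanish
    for k > n.  Each factor 1 + X is unchanged when its coefficients are
    reversed, and each factor 1 - X changes sign, so the product satisfies the
    palindromic relation with sign (-1)^i ([self_reciprocal_prod]).

    It remains to see that 0, ..., n are the only zeros of K_{n+1}(x; n).  As a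
    polynomial in x it has degree at most n + 1 and vanishes at these n + 1
    points; a further zero would force it to be identically zero.  But its value
    at x = n + 1 is (-2)^(n + 1) ([krawtchoukr_at_succ]), because every binomial
    coefficient of n - x = -1 is a sign and the defining sum then collapses by
    the binomial theorem.  Hence every zero is some i <= n
    ([krawtchoukr_zero]), and theta(i) = (-1)^i. *)

Set Implicit Arguments.
Unset Strict Implicit.
Unset Printing Implicit Defensive.

Import GRing.Theory Num.Theory.

Local Open Scope ring_scope.

(** The proof needs only values: [binr] and [krawtchoukr] are the values of
    [gbinom] and [krawtchouk] at a point. *)
Definition binr (F : fieldType) (u : F) (m : nat) : F :=
  m`!%:R^-1 * \prod_(i < m) (u - i%:R).

Definition krawtchoukr (F : fieldType) (k : nat) (s t : F) : F :=
  \sum_(j < k.+1) (-1) ^+ j * binr s j * binr (t - s) (k - j).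

Lemma eval2_gbinom (F : fieldType) (u : {mpoly F[2]}) (m : nat) (s t : F) :
  eval2 (gbinom u m) s t = binr (eval2 u s t) m.
Proof.
rewrite /eval2 /gbinom mevalZ rmorph_prod; congr (_ * _).
by apply: eq_bigr => i _; rewrite rmorphB rmorph_nat.
Qed.

Lemma eval2_krawtchouk (F : fieldType) (k : nat) (s t : F) :
  eval2 (krawtchouk F k) s t = krawtchoukr k s t.
Proof.
rewrite /eval2 /krawtchouk raddf_sum; apply: eq_bigr => j _ /=.
rewrite !mevalM rmorphXn rmorphN1 -!/(eval2 _ s t) !eval2_gbinom.
by rewrite /eval2 mevalB !mevalXU !(tnth_nth 0).
Qed.

Lemma binr_nat (F : numFieldType) (n m : nat) : binr (n%:R : F) m = 'C(n, m)%:R.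
Proof.
rewrite /binr; have fact_neq0 : m`!%:R != 0 :> F by rewrite pnatr_eq0 -lt0n fact_gt0.
have -> : \prod_(i < m) (n%:R - i%:R) = (n ^_ m)%:R :> F.
  elim: m {fact_neq0} => [|m IHm]; first by rewrite big_ord0.
  rewrite big_ord_recr /= IHm ffactnSr natrM.
  have [le_mn | lt_nm] := leqP m n; first by rewrite natrB.
  by rewrite ffact_small // !mul0r.
by rewrite -bin_ffact natrM mulrC mulfK.
Qed.

Lemma binrN1 (F : numFieldType) (m : nat) : binr (-1 : F) m = (-1) ^+ m.
Proof.
rewrite /binr; have fact_neq0 : m`!%:R != 0 :> F by rewrite pnatr_eq0 -lt0n fact_gt0.
suff -> : \prod_(i < m) (-1 - i%:R) = (-1) ^+ m * m`!%:R :> F.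
  by rewrite mulrC mulfK.
elim: m {fact_neq0} => [|m IHm]; first by rewrite big_ord0 mulr1.
rewrite big_ord_recr /= {}IHm factS natrM -opprD -natr1 exprS.
by rewrite [1 + _]addrC mulrN !mulN1r mulNr -mulrA [_ * (_ + 1)]mulrC.
Qed.

Lemma coef_exp1DZX (R : comNzRingType) (c : R) (n k : nat) :
  ((1 + c *: 'X) ^+ n)`_k = c ^+ k *+ 'C(n, k).
Proof.
elim: n k => [|n IHn] [|k]; rewrite ?expr0 ?coef1 //.
- by rewrite exprS mulrDl mul1r -scalerAl coefD coefZ coefXM /= IHn mulr0 addr0 !bin0.
- rewrite exprS mulrDl mul1r -scalerAl coefD coefZ coefXM /= !IHn binS mulrnDr.
  by rewrite exprS mulrnAr.
Qed.

(** Both sides are the convolution of the coefficients of the two powers; this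
    is where the generating function of the Krawtchouk polynomials enters. *)
Lemma krawtchoukr_coef (F : numFieldType) (i l k : nat) :
  krawtchoukr k (i%:R : F) (i + l)%:R =
  ((1 + (-1) *: 'X) ^+ i * (1 + 1 *: 'X) ^+ l)`_k.
Proof.
rewrite coefM; apply: eq_bigr => j _; rewrite !coef_exp1DZX expr1n.
by rewrite natrD addrAC subrr add0r !binr_nat [_ ^+ _ * _]mulr_natr.
Qed.

(** The bound n is a parameter rather than the degree of p, so that the notion
    does not depend on whether the coefficient of degree n vanishes. *)
Definition self_reciprocal (R : nzRingType) (e : R) (n : nat) (p : {poly R}) :=
  (forall k, (n < k)%N -> p`_k = 0) /\
  (forall k, (k <= n)%N -> p`_k = e * p`_(n - k)).

(** When c is its own inverse, reversing the coefficients of 1 + c X multiplies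
    it by c; reversal is multiplicative, so the signs c and e multiply. *)
Lemma self_reciprocalM1DZX (R : comNzRingType) (c e : R) (n : nat)
    (p : {poly R}) :
    c * c = 1 -> self_reciprocal e n p ->
  self_reciprocal (c * e) n.+1 ((1 + c *: 'X) * p).
Proof.
move=> cc1 [p_small p_sym].
have coefE k : ((1 + c *: 'X) * p)`_k =
    p`_k + c * (if k is k'.+1 then p`_k' else 0).
  by rewrite mulrDl mul1r -scalerAl coefD coefZ coefXM; case: k.
split=> [[//|k] ltnk|[_|k lekn]]; rewrite !coefE.
- by rewrite !p_small ?mulr0 ?addr0 // ltnW.
- rewrite subn0 [p`_n.+1]p_small // mulr0 addr0 add0r mulrACA cc1 mul1r.
  by rewrite p_sym // subn0.
(* The two terms on each side are exchanged by the symmetry of p. *)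
rewrite subSS mulrDr [p`_k]p_sym // mulrA addrC; congr (_ + _).
(* For k = n the predecessor of n - k is missing and both sides are 0. *)
have [ltkn|] := ltnP k n; last first.
  move=> lenk; have -> : k = n by apply/eqP; rewrite eqn_leq lenk andbT.
  by rewrite subnn p_small // !mulr0.
by rewrite -subnSK //= p_sym // mulrACA cc1 mul1r.
Qed.

Lemma self_reciprocal_prod (R : comNzRingType) (i l : nat) :
  self_reciprocal ((-1) ^+ i : R) (i + l)
    ((1 + (-1) *: 'X) ^+ i * (1 + 1 *: 'X) ^+ l).
Proof.
elim: i => [|i IHi]; last first.
  rewrite addSn !exprS -mulrA; apply: self_reciprocalM1DZX => //.
  by rewrite mulrNN mulr1.
rewrite expr0 mul1r add0n; elim: l => [|l IHl]; last first.
  rewrite exprS -{1}(mulr1 1).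
  by apply: self_reciprocalM1DZX => //; rewrite mulr1.
by rewrite expr0; split=> [[|k]|[|k]] //; rewrite ?coef1 // mul1r.
Qed.

Lemma krawtchoukr_gt (F : numFieldType) (n i k : nat) :
  (i <= n)%N -> (n < k)%N -> krawtchoukr k (i%:R : F) n%:R = 0.
Proof.
move=> lein ltnk; rewrite -(subnKC lein) krawtchoukr_coef.
by have [small _] := self_reciprocal_prod F i (n - i); rewrite small ?subnKC.
Qed.

Lemma krawtchoukr_sym (F : numFieldType) (n i k : nat) :
    (i <= n)%N -> (k <= n)%N ->
  krawtchoukr k (i%:R : F) n%:R =
  (-1) ^+ i * krawtchoukr (n - k) (i%:R : F) n%:R.
Proof.
move=> lein lekn; rewrite -(subnKC lein) !krawtchoukr_coef.
by have [_ ->] := self_reciprocal_prod F i (n - i); rewrite ?subnKC.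
Qed.

(** At s = n + 1 the second binomial coefficient has upper entry -1, and the sum
    becomes the expansion of (-1 + -1)^(n + 1).  This is the simplest witness
    that K_{n+1}(x; n) is not the zero polynomial in x. *)
Lemma krawtchoukr_at_succ (F : numFieldType) (n : nat) :
  krawtchoukr n.+1 (n.+1%:R : F) n%:R = (-2) ^+ n.+1.
Proof.
have -> : -2 = -1 + -1 :> F by rewrite -opprD.
rewrite exprDn; apply: eq_bigr => j _.
have -> : n%:R - n.+1%:R = -1 :> F by rewrite -natr1 opprD addrA subrr add0r.
by rewrite binrN1 binr_nat -mulrA mulrCA mulr_natl mulrC.
Qed.

(** [krawtchoukp k t] is K_k(x; t) as a polynomial in x alone, the form needed to
    count roots. *)
Definition binp (F : fieldType) (u : {poly F}) (m : nat) : {poly F} :=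
  m`!%:R^-1 *: \prod_(i < m) (u - i%:R%:P).

Definition krawtchoukp (F : fieldType) (k : nat) (t : F) : {poly F} :=
  \sum_(j < k.+1) (-1) ^+ j *: (binp 'X j * binp (t%:P - 'X) (k - j)).

Lemma horner_krawtchoukp (F : fieldType) (k : nat) (s t : F) :
  (krawtchoukp k t).[s] = krawtchoukr k s t.
Proof.
have hornerB (u : {poly F}) m : (binp u m).[s] = binr u.[s] m.
  rewrite hornerZ horner_prod; congr (_ * _).
  by apply: eq_bigr => i _; rewrite hornerD hornerN hornerC.
rewrite horner_sum; apply: eq_bigr => j _.
by rewrite hornerZ hornerM !hornerB mulrA !hornerE.
Qed.

Lemma size_binp_leq (F : fieldType) (u : {poly F}) (m : nat) :
  (size u <= 2)%N -> (size (binp u m) <= m.+1)%N.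
Proof.
move=> size_u; apply: leq_trans (size_scale_leq _ _) _.
elim: m => [|m IHm]; first by rewrite big_ord0 size_poly1.
rewrite big_ord_recr /=; apply: leq_trans (size_polyMleq _ _) _.
have size_factor : (size (u - m%:R%:P)%R <= 2)%N.
  apply: leq_trans (size_polyD _ _) _.
  by rewrite size_polyN geq_max size_u (leq_trans (size_polyC_leq1 _)).
by rewrite -subn1 leq_subLR (leq_trans (leq_add IHm size_factor)) // addn2.
Qed.

Lemma size_krawtchoukp (F : fieldType) (k : nat) (t : F) :
  (size (krawtchoukp k t) <= k.+1)%N.
Proof.
apply: leq_trans (size_sum _ _ _) _; apply/bigmax_leqP => j _.
apply: leq_trans (size_scale_leq _ _) _.
apply: leq_trans (size_polyMleq _ _) _.
have size_lin : (size (t%:P - 'X)%R <= 2)%N.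
  apply: leq_trans (size_polyD _ _) _.
  by rewrite size_polyN size_polyX geq_max (leq_trans (size_polyC_leq1 _)).
have sizeX := @size_binp_leq F 'X j (eq_leq (size_polyX _)).
have := leq_add sizeX (@size_binp_leq F _ (k - j) size_lin).
by rewrite addSn addnS subnKC -1?ltnS // -subn1 leq_subLR.
Qed.

(** A zero s outside 0, ..., n would give n + 2 distinct roots to a nonzero
    polynomial of degree at most n + 1. *)
Lemma krawtchoukr_zero (F : numFieldType) (n : nat) (s : F) :
    krawtchoukr n.+1 s n%:R = 0 ->
  exists2 i : nat, (i <= n)%N & s = i%:R.
Proof.
move=> Ks0; set q := krawtchoukp n.+1 (n%:R : F).
have q_neq0 : q != 0.
  apply: contraTneq isT => q0.
  have := krawtchoukr_at_succ F n; rewrite -horner_krawtchoukp -/q q0 horner0.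
  by move/esym/eqP; rewrite expf_eq0 oppr_eq0 pnatr_eq0.
pose rs : seq F := [seq i%:R | i <- iota 0 n.+1].
have rsP x : reflect (exists2 i : nat, (i <= n)%N & x = i%:R) (x \in rs).
  apply: (iffP mapP) => -[j]; first by rewrite mem_iota; exists j.
  by move=> lejn ->; exists j; rewrite ?mem_iota.
apply/rsP; apply: contraTT isT => s_notin.
have roots : all (root q) (s :: rs).
  apply/allP => x; rewrite inE => /predU1P[->|/rsP[i lein ->]].
    by apply/rootP; rewrite horner_krawtchoukp.
  by apply/rootP; rewrite horner_krawtchoukp krawtchoukr_gt.
have uniq_rs : uniq (s :: rs).
  rewrite cons_uniq s_notin map_inj_uniq ?iota_uniq // => i j /eqP.
  by rewrite eqr_nat => /eqP.
have := max_poly_roots q_neq0 roots uniq_rs.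
rewrite /= size_map size_iota ltnNge.
by rewrite (size_krawtchoukp n.+1 (n%:R : F)).
Qed.

Theorem theorem1p32 (R : realType) :
  palindromic_pair (krawtchouk R[i])
    (fun _ : nat => 1 : R[i]) (fun n : nat => n%:R : R).
Proof.
split=> [|k|n m /eqP].
- by rewrite /krawtchouk big_ord1 /gbinom !big_ord0 !invr1 !scale1r !mulr1.
- exact: oner_neq0.
rewrite eqr_nat => /eqP <-.
(* theta is the parity character of the zeros, which are natural numbers. *)
pose odds : seq R[i] := [seq i%:R | i <- iota 0 n.+1 & odd i].
exists (fun s => (-1) ^+ (s \in odds)).
  by move=> s _ /=; case: (s \in odds); [right | left].
move=> s; rewrite /zeros /= eval2_krawtchouk => /krawtchoukr_zero[i lein ->].
split=> k; first by move=> ltnk; rewrite eval2_krawtchouk krawtchoukr_gt.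
have -> : (i%:R \in odds) = odd i.
  apply/mapP/idP => [[j] | odd_i].
    by rewrite mem_filter => /andP[odd_j _] /eqP; rewrite eqr_nat => /eqP ->.
  by exists i; rewrite // mem_filter odd_i mem_iota.
by move=> lekn; rewrite !eval2_krawtchouk !divr1 signr_odd krawtchoukr_sym.
Qed.
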